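(* Let $q$ be a prime power and let $k\ge 0$ be an integer with $k\le q+1$. Let $W$ be a $\mathrm{GL}_2(\mathbb F_q)$-invariant subspace of $\mathbb F_q[X,Y]_k$. Then the following are equivalent: (i) $\mathcal B_W\neq\varnothing$; (ii) there exists a $k$-subset $S\subseteq\mathbb P^1(\mathbb F_q)$ such that $F_S\in W$; (iii) $W$ contains a nonzero polynomial $f$ vanishing at exactly $k$ distinct points of $\mathbb P^1(\mathbb F_q)$. If, in addition, $k\le q$, then conditions (i), (ii) and (iii) are also equivalent to (iv) $d(C_W)=q+1-k$.
   Context: $\mathbb F_q[X,Y]_k$ is the $\mathbb F_q$-space of homogeneous polynomials of degree $k$ in $X,Y$ over $\mathbb F_q$ (including $0$). The group $\mathrm{GL}_2(\mathbb F_q)$ acts on it by $(g\cdot f)(X,Y)=f(dX-bY,-cX+aY)$ for $g=\begin{pmatrix}a&b\\c&d\end{pmatrix}$; an $\mathbb F_q$-subspace $W$ is $\mathrm{GL}_2(\mathbb F_q)$-invariant if $g\cdot f\in W$ for all $g\in\mathrm{GL}_2(\mathbb F_q)$, $f\in W$. $\mathbb P^1(\mathbb F_q)=\mathbb F_q\cup\{\infty\}$, where $x\in\mathbb F_q$ corresponds to $[x:1]$ and $\infty$ to $[1:0]$. The value of $f\in \mathbb F_q[X,Y]_k$ at $x\in\mathbb F_q$ is $f(x,1)$, and at $\infty$ it is $f(1,0)$. For a $k$-subset $S\subseteq\mathbb P^1(\mathbb F_q)$, $F_S(X,Y)=\prod_{t\in S}(X-tY)$, where the factor for $t=\infty$ is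 taken to be $Y$. The block set is $\mathcal B_W=\{S\subseteq\mathbb P^1(\mathbb F_q): |S|=k,\ F_S\in W\}$. The evaluation map is $\mathrm{Ev}:\mathbb F_q[X,Y]_k\to\mathbb F_q^{q+1}$, $f\mapsto((f(a,1))_{a\in\mathbb F_q},f(1,0))$, and $C_W=\mathrm{Ev}(W)$. For a linear code $C$, $d(C)$ is its minimum distance, i.e. the minimum Hamming weight of a nonzero codeword; the assertion $d(C)=n$ means that $C$ has nonzero codewords and the minimum of their weights is $n$. *)

(* Defs.v *)
From HB Require Import structures.
From mathcomp Require Import all_boot all_algebra all_fingroup.
From mathcomp Require Export mpoly.

Set Implicit Arguments.
Unset Strict Implicit.
Unset Printing Implicit Defensive.

Import GRing.Theory.
Local Open Scope ring_scope.

(* The space of binary forms of degree k is [dhomog 2 F k]; the variables X    *)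
(* and Y are ['X_0] and ['X_1].                                                *)
Notation binary_form F k := (dhomog 2 F k).

Definition mX (F : finFieldType) : {mpoly F[2]} := 'X_0.
Definition mY (F : finFieldType) : {mpoly F[2]} := 'X_1.

Definition pair2 (A : Type) (a b : A) : 2.-tuple A := [tuple a; b].

Lemma homog_comp (F : finFieldType) (k : nat) (p : {mpoly F[2]})
    (u : 2.-tuple {mpoly F[2]}) :
  (forall i, tnth u i \is 1.-homog) -> p \is k.-homog -> p \mPo u \is k.-homog.
Proof.
move=> hu /dhomogP hp; rewrite comp_mpolyEX big_seq; apply: rpred_sum => m hm.
apply: dhomogZ; rewrite comp_mpolyX -(hp _ hm) /= mdegE.
elim/big_rec2: _ => [|i d q _ hq]; first exact: dhomog1.
by apply: dhomogM => //; have := dhomogMn (m i) (hu i); rewrite mul1n.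
Qed.

Lemma homog_lin (F : finFieldType) (a b : F) :
  a *: mX F + b *: mY F \is 1.-homog.
Proof. by apply: dhomogD; apply: dhomogZ; rewrite dhomogX /= mdeg1. Qed.

Definition gl_subst (F : finFieldType) (g : 'M[F]_2) : 2.-tuple {mpoly F[2]} :=
  pair2 (g 1 1 *: mX F - g 0 1 *: mY F) (- g 1 0 *: mX F + g 0 0 *: mY F).

Lemma gl_act_homog (F : finFieldType) (k : nat) (g : 'M[F]_2) (f : binary_form F k) :
  mpoly_of_dhomog f \mPo gl_subst g \is k.-homog.
Proof.
apply: homog_comp (dhomog_is_dhomog f) => i.
rewrite (tnth_nth 0); case: i => -[|[|//]] hi /=; last exact: homog_lin.
by rewrite -scaleNr; exact: homog_lin.
Qed.

Definition gl_act (F : finFieldType) (k : nat) (g : {'GL_2[F]}) (f : binary_form F k) :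
    binary_form F k :=
  DHomog (gl_act_homog (GLval g) f).

Definition gl_invariant (F : finFieldType) (k : nat) (W : {vspace binary_form F k}) :
    Prop :=
  forall (g : {'GL_2[F]}) (f : binary_form F k), f \in W -> gl_act g f \in W.

(* [Some x] is [x : 1] and [None] is the point at infinity [1 : 0]. *)
Definition P1 (F : finFieldType) : finType := option F.

Definition coords (F : finFieldType) (t : P1 F) : 2.-tuple F :=
  if t is Some x then pair2 x 1 else pair2 1 0.

Definition value (F : finFieldType) (k : nat) (f : binary_form F k) (t : P1 F) : F :=
  (mpoly_of_dhomog f).@[tnth (coords t)].

Definition F_factor (F : finFieldType) (t : P1 F) : {mpoly F[2]} :=
  if t is Some x then mX F - x *: mY F else mY F.

Definition F_prod (F : finFieldType) (S : {set P1 F}) : {mpoly F[2]} :=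
  \prod_(t in S) F_factor t.

Lemma F_prod_homog (F : finFieldType) (S : {set P1 F}) :
  F_prod S \is #|S|.-homog.
Proof.
rewrite /F_prod -sum1_card.
elim/big_rec2: _ => [|t p d _ hp]; first exact: dhomog1.
apply: dhomogM => //; case: t => [x|] /=; last by rewrite dhomogX /= mdeg1.
by rewrite -scaleNr -[mX F]scale1r; exact: homog_lin.
Qed.

(* F_S as an element of the space of forms of degree k. The projection         *)
(* [indhomog] returns 0 on polynomials that are not k-homogeneous, so this is  *)
(* meaningful only for #|S| = k, in which case it is F_prod S (see F_formE).   *)
Definition F_form (F : finFieldType) (k : nat) (S : {set P1 F}) : binary_form F k :=
  indhomog k (F_prod S).

Lemma F_formE (F : finFieldType) (k : nat) (S : {set P1 F}) :
  #|S| = k -> mpoly_of_dhomog (F_form k S) = F_prod S.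
Proof. by move=> <-; rewrite /F_form /indhomog insubdK //; exact: F_prod_homog. Qed.

Definition block_set (F : finFieldType) (k : nat) (W : {vspace binary_form F k}) :
    {set {set P1 F}} :=
  [set S : {set P1 F} | (#|S| == k) && (F_form k S \in W)].

(* F^(q+1), with coordinates indexed by the points of the projective line. *)
Definition Ev (F : finFieldType) (k : nat) (f : binary_form F k) :
    {ffun P1 F -> F^o} :=
  [ffun t => value f t].

Lemma Ev_is_linear (F : finFieldType) (k : nat) : linear (@Ev F k).
Proof.
move=> a f g; apply/ffunP => t; rewrite !ffunE /value.
by rewrite [mpoly_of_dhomog _]linearP mevalD mevalZ.
Qed.

HB.instance Definition _ (F : finFieldType) (k : nat) :=
  GRing.isLinear.Build F (binary_form F k) {ffun P1 F -> F^o} _ (@Ev F k)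
    (@Ev_is_linear F k).

Definition code (F : finFieldType) (k : nat) (W : {vspace binary_form F k}) :
    {vspace {ffun P1 F -> F^o}} :=
  (linfun (@Ev F k) @: W)%VS.

Definition hweight (F : finFieldType) (I : finType) (c : {ffun I -> F^o}) : nat :=
  #|[set i | c i != 0]|.

(* [min_distance_is C n] is "d(C) = n"; it is false for every n if C = 0. *)
Definition min_distance_is (F : finFieldType) (I : finType)
    (C : {vspace {ffun I -> F^o}}) (n : nat) : Prop :=
  (exists c, [/\ c \in C, c != 0 & hweight c = n]) /\
  (forall c, c \in C -> c != 0 -> (n <= hweight c)%N).

(* Main.v *)
Require Import Defs.
From mathcomp Require Import all_boot all_algebra.

(** Setting Y = 1 embeds the forms of degree k into the polynomials of degree
    at most k; the coefficient of degree k is then the value at infinity, so the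
    degree drops below k exactly when infinity is a zero. Hence a nonzero form
    has at most k zeros on the projective line, and one with exactly k zeros is
    a scalar multiple of the product of the corresponding linear factors. A
    codeword Ev f has weight q + 1 minus the number of zeros of f. *)

Set Implicit Arguments.
Unset Strict Implicit.
Unset Printing Implicit Defensive.

Import GRing.Theory.
Local Open Scope ring_scope.

(** Splits off the point at infinity, both in products of linear factors and in counts of zeros. *)
Lemma big_set_option (R : Type) (idx : R) (op : Monoid.com_law idx)
    (T : finType) (S : {set option T}) (G : option T -> R) :
  \big[op/idx]_(t in S) G t =
  op (if None \in S then G None else idx)
     (\big[op/idx]_(x | Some x \in S) G (Some x)).
Proof.
rewrite big_mkcond (bigD1 None) //=; congr (op _ _).
rewrite (reindex_omap Some id) => [|[]//].
by rewrite [RHS]big_mkcond; apply: eq_bigl => x; rewrite /= eqxx.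
Qed.

Lemma card_set_option (T : finType) (S : {set option T}) :
  #|S| = ((None \in S) + #|[set x | Some x \in S]|)%N.
Proof.
rewrite -sum1_card big_set_option /= -sum1dep_card.
by case: (None \in S).
Qed.

Section Forms.

Variable F : finFieldType.
Implicit Types (f : {mpoly F[2]}) (k : nat) (S : {set P1 F}).

Lemma mdeg2 (m : 'X_{1..2}) : mdeg m = (m 0%R + m 1%R)%N.
Proof.
rewrite mdegE !big_ord_recl big_ord0 addn0.
by congr (m _ + m _)%N; apply: val_inj.
Qed.

Definition dehom : {mpoly F[2]} -> {poly F} :=
  mmap (@polyC F) (fun i : 'I_2 => if i == 0 then 'X else 1).

Lemma dehomE f : dehom f = \sum_(m <- msupp f) f@_m *: 'X^(m 0).
Proof.
apply: eq_bigr => m _; rewrite mul_polyC; congr (_ *: _).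
by rewrite /mmap1 !big_ord_recl big_ord0 /= expr1n !mulr1.
Qed.

Lemma coef_dehom f i :
  (dehom f)`_i = \sum_(m <- msupp f | m 0 == i :> nat) f@_m.
Proof.
rewrite dehomE coef_sum [RHS]big_mkcond; apply: eq_bigr => m _.
by rewrite coefZ coefXn eq_sym; case: eqP; rewrite ?mulr1 ?mulr0.
Qed.

Lemma horner_dehom f x : (dehom f).[x] = f.@[tnth (coords (Some x))].
Proof.
rewrite dehomE mevalE horner_sum; apply: eq_bigr => m _.
rewrite hornerZ hornerXn !big_ord_recl big_ord0 /= !(tnth_nth 0) /=.
by rewrite expr1n !mulr1; congr (_ * _ ^+ m _); apply: val_inj.
Qed.

Lemma homog_mdeg k f m : f \is k.-homog -> m \in msupp f -> (m 0%R + m 1%R)%N = k.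
Proof. by move=> /dhomogP hf /hf /=; rewrite mdeg2. Qed.

Lemma coef_dehom_infty k f : f \is k.-homog ->
  (dehom f)`_k = f.@[tnth (coords None)].
Proof.
move=> hf; rewrite coef_dehom mevalE big_mkcond.
rewrite big_seq [RHS]big_seq; apply: eq_bigr => m /(homog_mdeg hf) <-.
rewrite !big_ord_recl big_ord0 /= !(tnth_nth 0) /= expr1n mul1r mulr1.
have -> : lift ord0 ord0 = 1 :> 'I_2 by apply: val_inj.
(* As k is now [m 0 + m 1], the test that [m 0] equals k says that [m 1] is 0; this matches
   [0 ^+ m 1], since 0 ^ 0 = 1. *)
by rewrite expr0n -{1}[m 0]addn0 eqn_add2l eq_sym; case: eqP; rewrite ?mulr1 ?mulr0.
Qed.

Lemma size_dehom k f : f \is k.-homog -> (size (dehom f) <= k.+1)%N.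
Proof.
move=> hf; apply/leq_sizeP => i lt_ki; rewrite coef_dehom big_seq_cond big1 //.
move=> m /andP[/(homog_mdeg hf) hm /eqP hi].
by rewrite -hi -hm ltnNge leq_addr in lt_ki.
Qed.

(** In a fixed degree the exponent of X determines the monomial, so each coefficient of [f]
    reappears alone as a coefficient of [dehom f]. *)
Lemma dehom_eq0 k f : f \is k.-homog -> dehom f = 0 -> f = 0.
Proof.
move=> hf f0; apply/mpolyP => m; rewrite mcoeff0.
have [hm|/memN_msupp_eq0//] := boolP (m \in msupp f).
have := coef_dehom f (m 0).
rewrite f0 coef0 big_mkcond (bigD1_seq m) ?msupp_uniq //= eqxx.
rewrite big_seq_cond big1 ?addr0 // => m' /andP[hm' ne_m].
case: eqP => // e0; case/eqP: ne_m.
have /eqP := homog_mdeg hf hm'.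
rewrite -(homog_mdeg hf hm) e0 eqn_add2l => /eqP e1.
by apply/mnmP => -[[|[|//]] hi]; [move: e0 | move: e1]; congr (m' _ = m _);
   apply: val_inj.
Qed.

Lemma dehom_F_prod S :
  dehom (F_prod S) = \prod_(x | Some x \in S) ('X - x%:P).
Proof.
rewrite /F_prod /dehom rmorph_prod /= big_set_option /= mmapX mmap1U /=.
(* The factor Y of the point at infinity becomes 1, whether or not infinity lies in [S]. *)
rewrite if_same mul1r; apply: eq_bigr => x _.
by rewrite rmorphB /= mmapZ !mmapX !mmap1U /= mulr1.
Qed.

Definition zeros f : {set P1 F} := [set t | f.@[tnth (coords t)] == 0].

Lemma size_dehom_zeros k f : f \is k.-homog ->
  ((None \in zeros f) + size (dehom f) <= k.+1)%N.
Proof.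
move=> hf; have := size_dehom hf; rewrite inE -(coef_dehom_infty hf).
have [h0|//] := eqP; rewrite leq_eqVlt add1n => /orP[/eqP hs|//].
(* At size k + 1 the leading coefficient would be the value at infinity, which is zero here. *)
have : dehom f != 0 by rewrite -size_poly_gt0 hs.
by rewrite -lead_coef_eq0 lead_coefE hs h0 eqxx.
Qed.

Lemma finite_zerosE f : [set x | Some x \in zeros f] = [set x | root (dehom f) x].
Proof. by apply/setP => x; rewrite !inE rootE horner_dehom. Qed.

Lemma card_finite_zeros_lt k f : f \is k.-homog -> f != 0 ->
  (#|[set x | Some x \in zeros f]| < size (dehom f))%N.
Proof.
move=> hf nz; rewrite finite_zerosE cardE; apply: max_poly_roots.
- by apply: contraNneq nz => /(dehom_eq0 hf) ->.
- by apply/allP => x; rewrite mem_enum inE.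
- exact: enum_uniq.
Qed.

Lemma card_zeros_le k f : f \is k.-homog -> f != 0 -> (#|zeros f| <= k)%N.
Proof.
move=> hf nz; rewrite -ltnS card_set_option -addnS.
apply: leq_trans (size_dehom_zeros hf).
by rewrite leq_add2l (card_finite_zeros_lt hf).
Qed.

Lemma form_eq_F_prod k f : f \is k.-homog -> f != 0 -> #|zeros f| = k ->
  exists2 c : F, c != 0 & f = c *: F_prod (zeros f).
Proof.
move=> hf nz hk.
have nzd : dehom f != 0 by apply: contraNneq nz => /(dehom_eq0 hf) ->.
(* With k zeros in all, the upper and lower bounds on the size meet, so [dehom f] has as many
   distinct roots as its degree and splits. *)
have hs : size (dehom f) = #|[set x | Some x \in zeros f]|.+1.
  apply/eqP; rewrite eqn_leq (card_finite_zeros_lt hf nz) andbT.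
  have := size_dehom_zeros hf.
  by rewrite -[in X in (_ <= X)%N]hk card_set_option -addnS leq_add2l.
exists (lead_coef (dehom f)); first by rewrite lead_coef_eq0.
(* Both sides are forms of degree k, so they may be compared after setting Y = 1; a factor Y lost
   there is restored by homogeneity. *)
apply/eqP; rewrite -subr_eq0; apply/eqP; apply: (@dehom_eq0 k).
  by rewrite rpredB // rpredZ // -hk F_prod_homog.
rewrite /dehom rmorphB /= mmapZ -/(dehom f) -/(dehom (F_prod _)) dehom_F_prod.
apply/eqP; rewrite subr_eq0 mul_polyC.
rewrite [X in X == _](@all_roots_prod_XsubC _ _ (enum [set x | Some x \in zeros f])).
- rewrite big_enum /=; apply/eqP; congr (_ *: _).
  by apply: eq_bigl => x; rewrite inE.
- by rewrite -cardE.
- by apply/allP => x; rewrite mem_enum finite_zerosE inE.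
- by rewrite uniq_rootsE enum_uniq.
Qed.

Lemma meval_F_factor (s t : P1 F) :
  ((F_factor t).@[tnth (coords s)] == 0) = (s == t).
Proof.
case: t => [x|]; case: s => [y|] /=;
  rewrite ?mevalB ?mevalZ !mevalXU !(tnth_nth 0) /= ?mulr1 ?mulr0 ?subr0.
- by rewrite subr_eq0.
- by rewrite oner_eq0.
- by rewrite oner_eq0.
- by rewrite !eqxx.
Qed.

Lemma zeros_F_prod S : zeros (F_prod S) = S.
Proof.
apply/setP => s; rewrite inE /F_prod rmorph_prod /=.
apply/prodf_eq0/idP => [[t tS]|sS]; first by rewrite meval_F_factor => /eqP ->.
by exists s; rewrite // meval_F_factor.
Qed.

Lemma F_prod_neq0 S : F_prod S != 0.
Proof.
apply/prodf_neq0 => t _; apply: contraTneq isT => t0.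
(* A factor vanishes only at its own point, so any second point of the line shows that it is
   nonzero. *)
have [s st] : exists s : P1 F, s != t.
  by case: t {t0} => [x|]; [exists None | exists (Some 0)].
by rewrite -(meval_F_factor s t) t0 meval0 eqxx in st.
Qed.

Lemma hweight_Ev k (f : binary_form F k) :
  hweight (Ev f) = (#|F|.+1 - #|zeros (mpoly_of_dhomog f)|)%N.
Proof.
rewrite /hweight -(card_option F) -(cardsC (zeros (mpoly_of_dhomog f))) addKn.
by apply: eq_card => t; rewrite !inE ffunE.
Qed.

End Forms.

Theorem proposition3 (F : finFieldType) (k : nat) (W : {vspace binary_form F k}) :
  (k <= #|F|.+1)%N ->
  gl_invariant W ->
  [<-> (* i *) block_set W != set0;
       (* ii *) exists S : {set P1 F}, #|S| = k /\ F_form k S \in W;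
       (* iii *) exists f : binary_form F k,
                   [/\ f \in W, f <> 0%R & #|[set t | value f t == 0%R]| = k]]
  /\ ((k <= #|F|)%N ->
      (block_set W != set0 <-> min_distance_is (code W) (#|F|.+1 - k))).
Proof.
move=> le_k1 _.
have form_neq0 (f : binary_form F k) : f <> 0 -> mpoly_of_dhomog f != 0.
  by move=> nz; apply/eqP => f0; apply: nz; apply: val_inj.
have zerosE (f : binary_form F k) :
  [set t | value f t == 0] = zeros (mpoly_of_dhomog f) by [].
have i_ii : block_set W != set0 ->
    exists S : {set P1 F}, #|S| = k /\ F_form k S \in W.
  by case/set0Pn => S; rewrite inE => /andP[/eqP hS SW]; exists S.
have ii_iii (S : {set P1 F}) : #|S| = k ->
    F_form k S <> 0 /\ #|zeros (mpoly_of_dhomog (F_form k S))| = k.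
  move=> hS; rewrite F_formE // zeros_F_prod; split=> // S0.
  by have := F_prod_neq0 S; rewrite -(F_formE hS) S0 eqxx.
have iii_i (f : binary_form F k) : f \in W -> f <> 0 ->
    #|zeros (mpoly_of_dhomog f)| = k -> block_set W != set0.
  move=> fW /form_neq0 nz hk; apply/set0Pn; exists (zeros (mpoly_of_dhomog f)).
  rewrite inE hk eqxx /=.
  have [c c0 fE] := form_eq_F_prod (dhomog_is_dhomog f) nz hk.
  (* [W] is closed under scalars, so dividing [f] by [c] places the product itself in [W]. *)
  suff -> : F_form k (zeros (mpoly_of_dhomog f)) = c^-1 *: f by rewrite memvZ.
  apply: val_inj; rewrite /= F_formE // [RHS]linearZ /=.
  by rewrite [in RHS]fE scalerA mulVf // scale1r.
split.
  tfae=> //.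
  - by case=> S [hS SW]; exists (F_form k S); have [] := ii_iii S hS.
  - by case=> f [fW nz]; rewrite zerosE; exact: iii_i.
move=> le_k; split=> [/i_ii[S [hS SW]]|[[_ [/memv_imgP[f fW ->]]]]].
  have [nz hz] := ii_iii S hS; split.
    have hw : hweight (Ev (F_form k S)) = (#|F|.+1 - k)%N by rewrite hweight_Ev hz.
    exists (Ev (F_form k S)); split=> //.
      by apply/memv_imgP; exists (F_form k S); rewrite ?lfunE.
    apply/eqP => E0; move: hw; rewrite E0 /hweight.
    have -> : [set i | (0 : {ffun P1 F -> F^o}) i != 0] = set0.
      by apply/setP => i; rewrite !inE ffunE eqxx.
    (* Here k <= q matters: the weight q + 1 - k is positive. For k = q + 1 the form would vanish
       everywhere and give the zero codeword. *)
    by rewrite cards0 subSn.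
  move=> _ /memv_imgP[f fW ->]; rewrite lfunE /= => E0; rewrite hweight_Ev leq_sub2l //.
  apply: card_zeros_le (dhomog_is_dhomog f) _; apply: form_neq0 => f0.
  by rewrite f0 linear0 eqxx in E0.
rewrite lfunE /= => E0 hw _; apply: (iii_i f fW) => [f0|].
  by rewrite f0 linear0 eqxx in E0.
(* Equal weights give equal numbers of zeros because the truncated subtractions start from q + 1,
   which bounds both k and the number of zeros. *)
move: hw; rewrite hweight_Ev => hw; rewrite -[LHS](@subKn _ #|F|.+1) ?hw ?subKn //.
by rewrite -(card_option F) max_card.
Qed.
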